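(* Let $G$ be a finite group such that the difference subgroup graph $D(G)$ has at least one edge and the independence number of $D(G)$ is at most $5$. Then $G$ is not nilpotent.
   Context: For a finite group $G$, the difference subgroup graph $D(G)$ is the undirected graph whose vertices are the non-trivial proper subgroups of $G$, with two distinct vertices $H$ and $K$ adjacent if and only if $\langle H,K\rangle = G$ and $HK\neq G$, where $HK=\{hk : h\in H,\ k\in K\}$. The independence number $\alpha(D(G))$ is the size of a largest set of pairwise non-adjacent vertices of $D(G)$. *)

(* Defs.v *)
From mathcomp Require Import all_boot all_fingroup all_solvable.

Set Implicit Arguments.
Unset Strict Implicit.
Unset Printing Implicit Defensive.

Local Open Scope group_scope.

(* A graph is given by a vertex set V inside a finite type T and an adjacency
   relation e on T, of which only the restriction to V matters. *)
Section Graph.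

Variables (T : finType) (V : {set T}) (e : rel T).

Definition has_edge : bool := [exists x in V, exists y in V, e x y].

Definition independent (S : {set T}) : bool :=
  (S \subset V) && [forall x in S, forall y in S, (x != y) ==> ~~ e x y].

Definition independence_number : nat := \max_(S : {set T} | independent S) #|S|.

End Graph.

Section DifferenceSubgroupGraph.

Variables (gT : finGroupType) (G : {group gT}).

Definition dsg_vertices : {set {group gT}} :=
  [set H : {group gT} | (H :!=: 1) && (H \proper G)].

Definition dsg_adj : rel {group gT} :=
  fun H K => [&& H != K, H <*> K == G & H * K != G].

End DifferenceSubgroupGraph.

(* Main.v *)
Require Import Defs.
From mathcomp Require Import all_boot all_fingroup all_solvable.

(** For an edge H - K of a nilpotent group G, the subgroups M = H G' and
    N = K G' are normal and proper, because G' consists of non-generators.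
    Neither contains the other, so some x lies outside both, and L = <x> G' is
    again normal and proper.  Normal subgroups have no neighbours, and all
    conjugates of H lie in M, so G', L, M, N, H and a conjugate of H distinct
    from H are six pairwise non-adjacent vertices. *)

Section DifferenceSubgroupGraphTheory.

Set Implicit Arguments.
Unset Strict Implicit.

Local Open Scope group_scope.

Variables (gT : finGroupType) (G : {group gT}).
Implicit Types H K M : {group gT}.

(** A subnormal subgroup is either the whole group or has a proper normal closure [N]. In the second
    case [G / N] is solvable and nontrivial, hence not perfect; but [H] dies in [G / N], so H G' = G
    would make it perfect. *)
Lemma nilpotent_joing_der1_proper H :
  nilpotent G -> H \proper G -> H <*> G^`(1) \proper G.
Proof.
move=> nilG ltHG; have sHG := proper_sub ltHG.
have [eqHG | ltNG] := subnormalEsupport (nilpotent_subnormal nilG sHG).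
  by rewrite eqHG properxx in ltHG.
set N := <<class_support H G>>%G in ltNG.
have nNG : G \subset 'N(N) by rewrite norms_gen ?class_support_norm.
have sHN : H \subset N by rewrite sub_gen ?sub_class_support.
have ltDQ : (G / N)^`(1) \proper G / N.
  rewrite (sol_der1_proper (quotient_sol _ (nilpotent_sol nilG))) //.
  by rewrite -subG1 quotient_sub1 //; case/andP: ltNG.
rewrite properEneq join_subG sHG der_sub !andbT.
apply: contraTneq ltDQ => defG.
rewrite -quotient_der // -{2}defG quotientY ?(subset_trans _ nNG) ?der_sub //.
by rewrite (quotientS1 sHN) joing1G properxx.
Qed.

Lemma joing_der1_normal H : H \subset G -> H <*> G^`(1) <| G.
Proof.
by move=> sHG; rewrite sub_der1_normal ?joing_subr // join_subG sHG der_sub.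
Qed.

Lemma dsg_adj_sym : symmetric (dsg_adj G).
Proof.
move=> H K; rewrite /dsg_adj eq_sym joingC; congr [&& _, _ & ~~ _].
(* Inversion fixes [G] and exchanges [H * K] with [K * H]. *)
by apply/eqP/eqP => defG; rewrite -[RHS]invGid -defG invMg !invGid.
Qed.

(** If [K] normalizes [H], then [H * K] is already the join, and the two adjacency conditions
    contradict each other. *)
Lemma dsg_adj_not_normal H K : dsg_adj G H K -> ~~ (H <| G).
Proof.
case/and3P=> _ /eqP defG; apply: contra => /andP[_ nHG].
have nHK : K \subset 'N(H) by rewrite (subset_trans _ nHG) // -defG joing_subr.
by rewrite -norm_joinEr // defG.
Qed.

(** Both ends of an edge are non-normal, so both would lie in [M] and could not generate [G]. *)
Lemma independent_normal_or_sub M (S : {set {group gT}}) :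
    M \proper G -> S \subset dsg_vertices G ->
    {in S, forall H, (H <| G) || (H \subset M)} ->
  independent (dsg_vertices G) (dsg_adj G) S.
Proof.
move=> ltMG sSV nsS; rewrite /independent sSV.
apply/forall_inP=> H SH; apply/forall_inP=> K SK; apply/implyP=> _.
apply/negP=> adjHK; have nadjH := dsg_adj_not_normal adjHK.
have:= adjHK; rewrite dsg_adj_sym => /dsg_adj_not_normal nadjK.
have:= nsS H SH; rewrite (negPf nadjH) /= => sHM.
have:= nsS K SK; rewrite (negPf nadjK) /= => sKM.
case/and3P: adjHK => _ /eqP defG _.
by move: ltMG; rewrite properE -{2}defG join_subG sHM sKM andbF.
Qed.

Lemma nilpotent_dsg_independent H K :
    nilpotent G -> H \in dsg_vertices G -> K \in dsg_vertices G ->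
    dsg_adj G H K ->
  exists2 S : {set {group gT}},
    independent (dsg_vertices G) (dsg_adj G) S & #|S| = 6.
Proof.
rewrite !inE => nilG /andP[ntH ltHG] /andP[ntK ltKG] adjHK.
have not_nHG := dsg_adj_not_normal adjHK.
have [sHG sKG] := (proper_sub ltHG, proper_sub ltKG).
have defG : H <*> K = G by case/and3P: adjHK => _ /eqP.
pose D := G^`(1)%G; pose M := (H <*> D)%G; pose N := (K <*> D)%G.
have ltMG : M \proper G by apply: nilpotent_joing_der1_proper.
have ltNG : N \proper G by apply: nilpotent_joing_der1_proper.
have nsMG : M <| G := joing_der1_normal sHG.
have nsNG : N <| G := joing_der1_normal sKG.
have [sDM sDN] : D \subset M /\ D \subset N by rewrite !joing_subr.
have [sHM sKN] : H \subset M /\ K \subset N by rewrite !joing_subl.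
have /subsetPn[h Hh Nh] : ~~ (H \subset N).
  by apply: contraL ltNG => sHN; rewrite properE -{2}defG join_subG sHN sKN andbF.
have /subsetPn[k Kk Mk] : ~~ (K \subset M).
  by apply: contraL ltMG => sKM; rewrite properE -{2}defG join_subG sHM sKM andbF.
have [Mh Nk] := (subsetP sHM h Hh, subsetP sKN k Kk).
(* Since [h] lies in [M] only and [k] in [N] only, their product lies in neither. *)
pose x := h * k.
have Gx : x \in G by rewrite /x groupM ?(subsetP sHG h) ?(subsetP sKG k).
have Mx : x \notin M by rewrite /x groupMl.
have Nx : x \notin N by rewrite /x groupMr.
(* A cyclic [G] would be abelian, making [H] normal. *)
have ltxG : <[x]> \proper G.
  rewrite properEneq cycle_subG Gx andbT; apply: contraNneq not_nHG => defX.
  by rewrite -sub_abelian_normal // -defX cycle_abelian.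
pose L := (<[x]> <*> D)%G.
have ltLG : L \proper G by apply: nilpotent_joing_der1_proper.
have nsLG : L <| G by apply: joing_der1_normal; apply: proper_sub.
have Lx : x \in L by rewrite (subsetP (joing_subl _ _)) ?cycle_id.
have nsDG : D <| G := der_normal 1 G.
have ntD : D :!=: 1.
  by apply: contraNneq not_nHG => D1; rewrite sub_der1_normal // D1 sub1G.
have ltDG : D \proper G := sub_proper_trans sDM ltMG.
(* A [g] outside the normalizer of [H] gives the second conjugate. *)
have /subsetPn[g Gg NHg] : ~~ (G \subset 'N(H)).
  by apply: contra not_nHG => nHG; rewrite /normal sHG.
pose Hg := (H :^ g)%G.
have sHgM : Hg \subset M by rewrite sub_conjg (normP _) // groupV (subsetP (normal_norm nsMG)).
have not_nHgG : ~~ (Hg <| G) by rewrite -(conjGid Gg) normalJ.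
have neq_normal (A B : {group gT}) : ~~ (A <| G) -> B <| G -> A == B = false.
  by move=> nnA nB; apply: contraNF nnA => /eqP->.
have neqH A := neq_normal H A not_nHG; have neqHg A := neq_normal Hg A not_nHgG.
have neq_mem y (A B : {group gT}) : y \in B -> y \notin A -> A == B = false.
  by move=> By; apply: contraNF => /eqP->.
pose s := [:: H; Hg; D; L; M; N].
(* Normality separates [H] and [Hg] from the other four; those are told apart by membership of [x],
   [h] and [k]. *)
have uniq_s : uniq s.
  rewrite /= !inE !(neqH _ nsDG, neqH _ nsLG, neqH _ nsMG, neqH _ nsNG).
  rewrite !(neqHg _ nsDG, neqHg _ nsLG, neqHg _ nsMG, neqHg _ nsNG).
  rewrite (neq_mem x D L) ?(contra (subsetP sDM x)) //.
  rewrite (neq_mem h D M) ?(contra (subsetP sDN h)) //.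
  rewrite (neq_mem k D N) ?(contra (subsetP sDM k)) //.
  rewrite ![L == _]eq_sym !(neq_mem x _ L) // (neq_mem k M N) // !orbF !andbT.
  by apply: contra NHg => /eqP eqHg; apply/normP; rewrite {2}eqHg.
exists [set:: s]; last by rewrite cardsE (card_uniqP uniq_s).
apply: (independent_normal_or_sub ltMG).
  have ntDS (A : {group gT}) : D \subset A -> A :!=: 1.
    by move=> sDA; apply: contraNneq ntD => A1; rewrite -subG1 -A1.
  apply/subsetP=> A; rewrite !inE => /or4P[|||/or3P[]] /eqP->.
  - by rewrite ntH.
  (* [Hg] is nontrivial because conjugation preserves the order. *)
  - by rewrite -!cardG_gt1 cardJg cardG_gt1 ntH (sub_proper_trans sHgM).
  - by rewrite ntD.
  - by rewrite ltLG ntDS ?joing_subr.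
  - by rewrite ltMG ntDS.
  - by rewrite ltNG ntDS.
by move=> A; rewrite !inE => /or4P[|||/or3P[]] /eqP->;
  rewrite ?sHM ?sHgM ?nsDG ?nsLG ?nsMG ?nsNG ?orbT.
Qed.

End DifferenceSubgroupGraphTheory.

Theorem theorem5p1 (gT : finGroupType) (G : {group gT}) :
  has_edge (dsg_vertices G) (dsg_adj G) ->
  independence_number (dsg_vertices G) (dsg_adj G) <= 5 ->
  ~~ nilpotent G.
Proof.
case/exists_inP=> H VH /exists_inP[K VK adjHK] le5.
apply: contraL le5 => nilG; rewrite -ltnNge.
have [S indS cardS] := nilpotent_dsg_independent nilG VH VK adjHK.
by apply: (bigmax_sup S) => //; rewrite cardS.
Qed.
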